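(* Let $n\geq 1$ and $m\geq 0$ be integers and let $Y_{n,m}$ be the Yoke graph. Then: If $m\leq n$, then $\operatorname{diam}(Y_{n,m})=\lfloor\frac{n(m+1)}{2}\rfloor$. If $1=n\leq m$, then $\operatorname{diam}(Y_{n,m})=\binom{\lceil m/2\rceil+1}{2}+\binom{\lfloor m/2\rfloor+1}{2}$. Otherwise $1<n\leq m$, and: (1) if $2\mid (m-n)$ or $n\leq \lceil\frac{m+1}{2}\rceil$, then $\operatorname{diam}(Y_{n,m})=\binom{\lfloor\frac{m+n}{2}\rfloor+1}{2}+\binom{\lceil\frac{m-n}{2}\rceil+1}{2}$; (2) otherwise, $\operatorname{diam}(Y_{n,m})=\binom{\lfloor\frac{m+n}{2}\rfloor+1}{2}+\binom{\lceil\frac{m-n}{2}\rceil+1}{2}+n-\lceil\frac{m+1}{2}\rceil$.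
   Context: Elements of $\mathbb{Z}_n$ are identified with their smallest non-negative representatives $\{0,\dots,n-1\}$. For integers $n\geq1$, $m\geq0$, the Yoke graph $Y_{n,m}$ has as vertices all $u=(u_0,\dots,u_{m+1})\in\mathbb{Z}_n\times\{0,1\}^m\times\mathbb{Z}_n$ with $\sum_{i=0}^{m+1}u_i\equiv 0 \pmod n$. Two vertices $u,v$ are adjacent if there is $0\leq i\leq m$ such that $u_j=v_j$ for all $j\notin\{i,i+1\}$ and either ($u_i=v_i+1$ and $u_{i+1}=v_{i+1}-1$) or ($u_i=v_i-1$ and $u_{i+1}=v_{i+1}+1$), where arithmetic in the coordinates $0$ and $m+1$ is in $\mathbb{Z}_n$ and in the other coordinates is in $\mathbb{Z}$ (so they must stay in $\{0,1\}$). *)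

(* Defs.v *)
From mathcomp Require Import all_boot.
Set Implicit Arguments. Unset Strict Implicit. Unset Printing Implicit Defensive.

(* Raw data of a vertex u = (u_0, u_1..u_m, u_{m+1}) of Y_{n,m}:
   u_0, u_{m+1} in Z_n = {0..n-1} (as 'I_n), inner coordinates as bools. *)
Definition yraw (n m : nat) := ('I_n * m.-tuple bool * 'I_n)%type.

Definition ycoord (n m : nat) (u : yraw n m) (j : nat) : nat :=
  let: (a, s, b) := u in
  if j == 0 then nat_of_ord a
  else if j == m.+1 then nat_of_ord b
  else nat_of_bool (nth false s j.-1).

Definition yoke_cond (n m : nat) (u : yraw n m) : bool :=
  (\sum_(j < m.+2) ycoord u j) %% n == 0.

Definition yoke_vertex (n m : nat) := {u : yraw n m | yoke_cond u}.

Definition yplus1 (n m i x y : nat) : bool :=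
  if (i == 0) || (i == m.+1) then y == x.+1 %% n else y == x.+1.

Definition yoke_adj (n m : nat) : rel (yoke_vertex n m) :=
  fun u v =>
    let cu := ycoord (val u) in
    let cv := ycoord (val v) in
    [exists i : 'I_m.+1,
       [forall j : 'I_m.+2,
          ((j : nat) != i) && ((j : nat) != i.+1) ==> (cu j == cv j)]
       && ((yplus1 n m i (cv i) (cu i) && yplus1 n m i.+1 (cu i.+1) (cv i.+1))
        || (yplus1 n m i (cu i) (cv i) && yplus1 n m i.+1 (cv i.+1) (cu i.+1)))].

Definition dist_le (T : finType) (e : rel T) (u v : T) (k : nat) : Prop :=
  exists p : seq T, [/\ path e u p, last u p = v & size p <= k].

Definition diameter_is (T : finType) (e : rel T) (d : nat) : Prop :=
  (forall u v : T, dist_le e u v d) /\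
  (exists u v : T, forall k, dist_le e u v k -> d <= k).

(* Main.v *)
Require Import Defs.
From mathcomp Require Import all_boot all_order all_algebra zify.
Import Order.TTheory GRing.Theory Num.Theory.

(* A vertex is determined by its partial sums s_0, ..., s_m, an integer sequence
   with steps in {0, 1} that is unique up to adding a constant multiple of n, and
   an edge changes a single s_i by 1. Hence d(u, v) is the least value over k of
   sum_i |s_i - t_i + k n|, and the diameter is the maximum, over the integer
   sequences d_0, ..., d_m with steps in {-1, 0, 1}, of the distance sum from d
   to the best multiple of n.
   For the upper bound, if a sequence attains y and q of its terms exceed y, then
   these exceed it by at most 1 + 2 + ... + q in total. So an attained multiple
   of n that nearly halves the sequence is good, and otherwise most terms lie
   strictly between two consecutive multiples, whose distance sums one averages.
   Extremal sequences are either consecutive integers, or symmetric about n / 2: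
   constant (up to rounding) if m <= n, and with a doubled middle value in the
   last case. *)

Set Implicit Arguments. Unset Strict Implicit. Unset Printing Implicit Defensive.

(** * Triangular bounds on the excess over a value *)

Lemma bin2_double k : 'C(k + 1, 2) * 2 = k * k.+1.
Proof. by rewrite addn1 mulnC -mul_bin_diag bin1 mulnC. Qed.

Definition count_above (m : nat) (d : nat -> int) (y : int) : nat :=
  \sum_(i < m.+1) (y < d i)%R.
Definition excess (m : nat) (d : nat -> int) (y : int) : nat :=
  \sum_(i < m.+1) (y < d i)%R * `|d i - y|%N.

(** A climb starting at or below [y] cannot skip a height, so the last height is at most the number
    of terms above [y]; hence the [c]-th such term adds at most [c]. *)
Lemma excess_forward (m : nat) (d : nat -> int) (y : int) :
  (forall i, i < m -> `|d i.+1 - d i|%N <= 1) -> (d 0%N <= y)%R ->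
  2 * excess m d y <= count_above m d y * (count_above m d y).+1 /\
  (y < d m)%R * `|d m - y|%N <= count_above m d y.
Proof.
rewrite /excess /count_above; elim: m => [|m IHm] hd h0 /=.
  by rewrite !big_ord1; have ->: (y < d 0%N)%R = false by lia.
have [|//|h1 h2] := IHm; first by move=> i hi; apply: hd; lia.
have := hd m (ltnSn m).
rewrite 2!(big_ord_recr m.+1) /=; move: (\sum_(i < _) _) h1 h2 => S.
move: (\sum_(i < _) _) => c h1 h2 h3.
case: (boolP (y < d m.+1)%R) => h4; rewrite ?mul0n ?mul1n ?addn0 //; split; lia.
Qed.

(** Mirror image of [excess_forward], peeling terms off the front; index [m] is left to the other
    half when the two are glued. *)
Lemma excess_backward (m : nat) (d : nat -> int) (y : int) :
  (forall i, i < m -> `|d i.+1 - d i|%N <= 1) -> (d m <= y)%R ->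
  let c := \sum_(i < m) (y < d i)%R in
  (2 * \sum_(i < m) (y < d i)%R * `|d i - y|%N <= c * c.+1) /\
  (y < d 0%N)%R * `|d 0 - y|%N <= c.
Proof.
elim: m d => [|m IHm] d hd h0 /=.
  by split; [rewrite !big_ord0|have ->: (y < d 0%N)%R = false by lia].
have [||h1 h2] := IHm (fun i => d i.+1); [by move=> i hi; exact: (hd i.+1)|by []|].
have := hd 0 isT.
rewrite 2!big_ord_recl /=; move: h1 h2; rewrite /bump /=.
move: (\sum_(i < _) _) => S; move: (\sum_(i < _) _) => c h1 h2 h3.
case: (boolP (y < d 0%N)%R) => h4; rewrite ?mul0n ?mul1n ?add0n //; split; lia.
Qed.

(** Cutting at [j] leaves two one-sided pieces, and [c * c.+1] is superadditive in [c]. *)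
Lemma excess_le (m : nat) (d : nat -> int) (j : nat) :
  (forall i, i < m -> `|d i.+1 - d i|%N <= 1) -> j <= m ->
  2 * excess m d (d j) <= count_above m d (d j) * (count_above m d (d j)).+1.
Proof.
move=> hd hj; rewrite /excess /count_above.
have [|//|h1 _] := @excess_backward j d (d j); first by move=> i hi; apply: hd; lia.
have [||h2 _] := @excess_forward (m - j) (fun i => d (j + i)) (d j).
- by move=> i hi; rewrite addnS; apply: hd; lia.
- by rewrite addn0.
rewrite /excess /count_above in h2.
have split_at (F : nat -> nat) :
    \sum_(i < m.+1) F i = \sum_(i < j) F i + \sum_(i < (m - j).+1) F (j + i).
  have -> : m.+1 = j + (m - j).+1 by lia.
  by rewrite big_split_ord.
rewrite (split_at (fun i => nat_of_bool (d j < d i)%R)).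
rewrite (split_at (fun i => (d j < d i)%R * `|d i - d j|%N)).
move: h1 h2; do 2![move: (\sum_(i < j) _) => ?].
do 2![move: (\sum_(i < _) _) => ?]; nia.
Qed.

(** A discrete intermediate value argument: steps of size at most 1 cannot jump over [y]. *)
Lemma avoid_sign (m : nat) (d : nat -> int) (y : int) :
  (forall i, i < m -> `|d i.+1 - d i|%N <= 1) ->
  (forall i, i <= m -> d i <> y) ->
  (forall i, i <= m -> (d i < y)%R) \/ (forall i, i <= m -> (y < d i)%R).
Proof.
move=> hd hy.
case: (ltrgtP (d 0%N) y) => h0; last by case: (hy 0 isT).
- left; elim=> [//|i IHi] hi; have := hy _ hi; have := hd i hi.
  have := IHi (ltnW hi); lia.
- right; elim=> [//|i IHi] hi; have := hy _ hi; have := hd i hi.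
  have := IHi (ltnW hi); lia.
Qed.

Lemma dist_split (m : nat) (d : nat -> int) (y : int) :
  \sum_(i < m.+1) `|d i - y|%N =
  excess m d y + excess m (fun i => - d i)%R (- y)%R.
Proof.
rewrite -big_split; apply: eq_bigr => i _ /=.
by case: ltrgtP => h; case: ltrgtP; lia.
Qed.

(** The distances of a term in [[x, x + n]] to the two ends add up to [n]; outside, twice the
    overshoot is added. *)
Lemma dist_pair_split (m n : nat) (d : nat -> int) (x : int) :
  \sum_(i < m.+1) `|d i - x|%N + \sum_(i < m.+1) `|d i - (x + n)%R|%N =
  n * m.+1 + 2 * excess m (fun i => - d i)%R (- x)%R + 2 * excess m d (x + n)%R.
Proof.
have -> : n * m.+1 = \sum_(i < m.+1) n by rewrite sum_nat_const card_ord mulnC.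
rewrite !big_distrr -!big_split; apply: eq_bigr => i _ /=.
by do 2![case: ltrgtP => ?]; lia.
Qed.

(** The term at [j] itself counts on neither side, hence [m] and not [m.+1]. *)
Lemma count_above_opp (m : nat) (d : nat -> int) (j : nat) : j <= m ->
  count_above m d (d j) + count_above m (fun i => - d i)%R (- d j)%R <= m.
Proof.
move=> hj; rewrite -ltnS -[ltnRHS]card_ord -sum1_card -big_split /=.
have hj' : j < m.+1 by [].
rewrite (bigD1 (Ordinal hj')) //= [ltnRHS](bigD1 (Ordinal hj')) //= !ltxx.
rewrite !add0n ltnS; apply: leq_sum => i _.
by do 2![case: ltrgtP => ?]; lia.
Qed.

Lemma excess_eq0 (m : nat) (d : nat -> int) (y : int) :
  (forall i, i <= m -> (d i <= y)%R) -> excess m d y = 0.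
Proof. by move=> h; apply: big1 => -[i hi] _ /=; have := h i hi; case: ltrgtP. Qed.

Lemma count_above_eq0 (m : nat) (d : nat -> int) (y : int) :
  (forall i, i <= m -> (d i <= y)%R) -> count_above m d y = 0.
Proof. by move=> h; apply: big1 => -[i hi] _ /=; have := h i hi; case: ltrgtP. Qed.

Lemma count_above_full (m : nat) (d : nat -> int) (y : int) :
  (forall i, i <= m -> (y < d i)%R) -> count_above m d y = m.+1.
Proof.
move=> h; rewrite -[RHS]card_ord -sum1_card; apply: eq_bigr => -[i hi] _ /=.
by rewrite h.
Qed.

(** * A multiple of [n] close to the sequence *)

Lemma steps_bound (m : nat) (d : nat -> int) :
  (forall i, i < m -> `|d i.+1 - d i|%N <= 1) ->
  forall i, i <= m -> `|d i - d 0%N|%N <= i.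
Proof.
move=> hd; elim=> [|i IHi] hi; first lia.
have := hd i hi; have := IHi (ltnW hi); lia.
Qed.

(** Convexity: the total is largest when [p] and [q] are as far apart as allowed, namely [A] and
    [m - A]. *)
Lemma balanced_triangles (m A p q : nat) :
  A <= m -> m <= A.*2 -> p <= A -> q <= A -> p + q <= m ->
  p * p.+1 + q * q.+1 <= A * A.+1 + (m - A) * (m - A).+1.
Proof.
move=> hA hA2 hp hq hpq.
have [B hB] : exists B, m = A + B by exists (m - A); lia.
subst m; rewrite addKn.
have [h|h] := leqP p B; first by nia.
have [r hr] : exists r, A = p + r by exists (A - p); lia.
have [s hs] : exists s, p = B + s by exists (p - B); lia.
have : q <= B + r by lia.
subst A p; nia.
Qed.

(* [y] is the least multiple of [n] with at most [A] terms above it. Either it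
   is attained with at most [A] terms below it, or fewer than [m - A] terms lie
   above [y] and fewer than [m - A] lie below [y - n], and then one averages
   the two distance sums. *)
Lemma exists_close_multiple (m n A : nat) (d : nat -> int) :
  (forall i, i < m -> `|d i.+1 - d i|%N <= 1) -> 0 < n ->
  A <= m -> m <= A.*2 ->
  exists k : int, let G := \sum_(i < m.+1) `|d i - (k * n)%R|%N in
    2 * G <= A * A.+1 + (m - A) * (m - A).+1 \/
    2 * G <= n * m.+1 + 2 * ((m - A) * (m - A).-1).
Proof.
move=> hd n0 hA hA2.
have hb := steps_bound hd.
have hd' : forall i, i < m -> `|(- d i.+1)%R - (- d i)%R|%N <= 1.
  by move=> i hi; have := hd i hi; lia.
(* [K] exceeds every [|d i|], so all terms lie strictly between [y 0] and [y K.*2]; the shift by [K]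
   indexes the multiples by naturals. *)
pose K := (`|d 0%N| + m.+1)%N.
pose y (j : nat) : int := ((j%:Z - K%:Z) * n)%R.
have ex : exists j, count_above m d (y j) <= A.
  exists K.*2; rewrite count_above_eq0 // => i hi; have := hb i hi.
  have -> : y K.*2 = (K * n)%N by rewrite /y; lia.
  have : K <= K * n by rewrite leq_pmulr.
  rewrite {1}/K; lia.
case: (ex_minnP ex) => -[|j] hj hmin.
  move: hj; rewrite count_above_full; first lia.
  move=> i hi; have := hb i hi.
  have -> : y 0 = (- (K * n)%N%:Z)%R by rewrite /y; lia.
  have : K <= K * n by rewrite leq_pmulr.
  rewrite {1}/K; lia.
have hx : A < count_above m d (y j).
  by rewrite ltnNge; apply/negP => h; have := hmin _ h; rewrite ltnn.
have hxy : y j.+1 = (y j + n)%R by rewrite /y; lia.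
(* If [y j] is attained, fewer than [m - A] terms lie below it, as more than [A] lie above; if not,
   none lies below. *)
have lower : 2 * excess m (fun i => - d i)%R (- y j)%R <= (m - A) * (m - A).-1.
  case: (boolP [exists i : 'I_m.+1, d i == y j])
    => [/existsP[i /eqP hi]|/existsPn hne].
    have := count_above_opp d (ltn_ord i : i <= m).
    have := excess_le hd' (ltn_ord i : i <= m).
    by rewrite hi; move: (count_above m (fun _ => _) _) => c; nia.
  have [|h|h] := @avoid_sign m d (y j) hd.
  - by move=> i hi; have := hne (Ordinal (hi : i < m.+1)) => /= /eqP.
  - by move: hx; rewrite count_above_eq0 // => i hi; apply/ltW/h.
  - by rewrite excess_eq0 // => i hi; rewrite lerN2; apply/ltW/h.
(* If the upper excess is small too, the smaller of the two distance sums is at most their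
   average. *)
case: (boolP (2 * excess m d (y j.+1) <= (m - A) * (m - A).-1)) => [upper|].
  have := dist_pair_split m n d (y j); rewrite -hxy.
  move: upper lower; move: (_ * _.-1) (excess _ _ _) (excess _ _ _) (n * _).
  move=> b e1 e2 c upper lower H.
  have [h|h] := leqP (\sum_(i < m.+1) `|d i - y j|%N)
                     (\sum_(i < m.+1) `|d i - y j.+1|%N).
    by exists (j%:Z - K%:Z)%R => /=; right; move: h H; rewrite -/(y j);
      do 2!move: (bigop.body _ _ _) => ?; lia.
  by exists (j.+1%:Z - K%:Z)%R => /=; right; move: h H; rewrite -/(y j.+1);
      do 2!move: (bigop.body _ _ _) => ?; lia.
(* A large upper excess forces [y j.+1] to be attained: otherwise all terms lie on one side, with
   zero excess or too many terms above. *)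
case: (boolP [exists i : 'I_m.+1, d i == y j.+1])
    => [/existsP[i /eqP hi]|/existsPn hne].
  have := count_above_opp d (ltn_ord i : i <= m).
  have := excess_le hd' (ltn_ord i : i <= m).
  have := excess_le hd (ltn_ord i : i <= m).
  rewrite hi => e1 e2 c12 upper.
  exists (j.+1%:Z - K%:Z)%R => /=; left; rewrite -/(y j.+1) dist_split.
  (* More than [A] terms below would leave fewer than [m - A] above, and so a small upper excess. *)
  have q_le : count_above m (fun i => - d i)%R (- y j.+1)%R <= A.
    rewrite leqNgt; apply/negP => q_gt; case/negP: upper.
    by apply: leq_trans e1 _; rewrite mulnC leq_mul //; lia.
  by have := balanced_triangles hA hA2 hj q_le c12; lia.
have [|h|h] := @avoid_sign m d (y j.+1) hd.
- by move=> i hi; have := hne (Ordinal (hi : i < m.+1)) => /= /eqP.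
- by rewrite excess_eq0 // => i hi; apply/ltW/h.
- by move: hj; rewrite count_above_full //; lia.
Qed.

(** * Lower bounds for the extremal sequences *)

Lemma sum_rev_ord (m : nat) (F : nat -> nat) :
  \sum_(i < m.+1) F i = \sum_(i < m.+1) F (m - i).
Proof. by rewrite (reindex_inj rev_ord_inj). Qed.

Lemma sum_countdown (N B : nat) : B <= N -> 2 * (\sum_(i < N) (B - i)) = B * B.+1.
Proof.
elim: N B => [|N IHN] B hB; first by rewrite big_ord0; lia.
rewrite big_ord_recl /= (eq_bigr (fun i : 'I_N => B.-1 - i)).
  have := IHN B.-1; move: (bigop.body _ _ _) => S; nia.
by move=> i _; rewrite /bump /=; lia.
Qed.

Lemma sum_countup (m B : nat) : B <= m ->
  2 * (\sum_(i < m.+1) (i - (m - B))) = B * B.+1.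
Proof.
move=> hB; rewrite (sum_rev_ord _ (fun i => i - (m - B))).
rewrite -(@sum_countdown m.+1 B) ?leqW //; congr (2 * _).
by apply: eq_bigr => i _; have := ltn_ord i; lia.
Qed.

(* The sum of the distances at [i] and [m - i] is at least
   [max (m - 2 * i) (m - 2 * B)], with equality for [c = B]. *)
Lemma consecutive_dist_ge (m B : nat) (c : int) :
  B.*2 <= m -> (c <= B)%R \/ (m%:Z - B%:Z <= c)%R ->
  B * B.+1 + (m - B) * (m - B).+1 <= 2 * \sum_(i < m.+1) `|i - c|%N.
Proof.
move=> hB hc.
have hBm : B <= m by lia.
(* The triangular numbers become sums of truncated differences that total [|i - B|] at [i]; pairing
   [i] with [m - i] then allows a termwise comparison. *)
rewrite -(@sum_countdown m.+1 B) ?leqW // -(@sum_countup m (m - B)) ?leq_subr //.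
rewrite subKn // -mulnDr -big_split /= !mul2n -!addnn.
rewrite {2}(sum_rev_ord _ (fun i => B - i + (i - B))).
rewrite [leqRHS](_ : _ = \sum_(i < m.+1) `|i - c|%N +
  \sum_(i < m.+1) `|(m - i)%N - c|%N); last first.
  by rewrite -(sum_rev_ord _ (fun i => `|i - c|%N)).
rewrite -!big_split /=; apply: leq_sum => i _; have := ltn_ord i.
by case: hc; lia.
Qed.

(* When [m] is even the middle term is its own mirror image, which is why it
   is allowed to miss the symmetry about [n / 2] by one half. *)
Lemma symmetric_dist_ge (m n : nat) (d : nat -> int) (k : int) : 0 < n ->
  (forall i, i <= m -> (d i + d (m - i)%N)%R = n \/
                       i.*2 = m /\ (d i + d i + 1)%R = n) ->
  \sum_(i < m.+1) (`|d i| + `|d i - n|)%N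
    <= 2 * \sum_(i < m.+1) `|d i - (k * n)%R|%N + 1.
Proof.
move=> n0 hd.
(* No multiple of [n] lies strictly between [0] and [n]. *)
have : (k * n <= 0)%R \/ (n%:Z <= k * n)%R.
  by have [h|h] := lerP k 0%R; [left|right]; nia.
move: (k * n)%R => z hz.
(* Pays for the exceptional middle term, the source of the final [+ 1]. *)
have mid : \sum_(i < m.+1) (i.*2 == m) <= 1.
  have [h|h] := boolP (m./2.*2 == m).
    have hm : m./2 < m.+1 by lia.
    rewrite (bigD1 (Ordinal hm)) //= big1 ?addn0 ?leq_b1 // => i.
    by rewrite -val_eqE /=; lia.
  by rewrite big1 // => i _; move: h; lia.
apply: (@leq_trans (2 * \sum_(i < m.+1) `|d i - z|%N
                    + \sum_(i < m.+1) (i.*2 == m))); last by rewrite leq_add2l.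
rewrite mul2n -addnn {2}(sum_rev_ord _ (fun i => `|d i - z|%N)) -!big_split /=.
apply: leq_sum => i _.
have him : i <= m by rewrite -ltnS.
have [h|[h1 h2]] := hd i him; first by case: hz; lia.
have -> : m - i = i by lia.
by rewrite h1 eqxx; case: hz; lia.
Qed.

(** Every term lies in [[0, n]], so its distances to [0] and [n] add up to [n]; rounding down first
    and up later gives the symmetry. *)
Lemma halves_dist_ge (m n : nat) (k : int) : 0 < n ->
  n * m.+1 <=
  2 * \sum_(i < m.+1) `|(if i.*2 <= m then n./2 else uphalf n) - (k * n)%R|%N + 1.
Proof.
move=> n0.
pose d i : int := if i.*2 <= m then n./2 else uphalf n.
apply: leq_trans (@symmetric_dist_ge m n d k n0 _); last first.
  move=> i hi; rewrite /d.
  by case: (leqP i.*2 m) => ?; case: (leqP (m - i).*2 m) => ?; lia.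
have -> : n * m.+1 = \sum_(i < m.+1) n by rewrite sum_nat_const card_ord mulnC.
by apply: leq_sum => i _; rewrite /d; case: leqP; lia.
Qed.

(** The sequence runs from [- B] to [n + B] with a middle value repeated; the overshoots [1, ..., B]
    on both sides of [[0, n]] give [2 * (B * B.+1)]. *)
Lemma doubled_middle_dist_ge (m n B : nat) (k : int) : 0 < n -> m = n + B.*2.+1 ->
  n * m.+1 + 2 * (B * B.+1) <=
  2 * \sum_(i < m.+1)
        `|(i%:Z - (if (i.*2 < m)%N then B else B.+1)%:Z)%R - (k * n)%R|%N + 1.
Proof.
move=> n0 hm.
pose d i := (i%:Z - (if (i.*2 < m)%N then B else B.+1)%:Z)%R.
apply: leq_trans (@symmetric_dist_ge m n d k n0 _); last first.
  move=> i hi; rewrite /d.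
  by case: (ltnP i.*2 m) => ?; case: (ltnP (m - i).*2 m) => ?; lia.
rewrite mul2n -addnn -{1}(@sum_countdown m.+1 B) -?(@sum_countup m B); try lia.
have -> : n * m.+1 = \sum_(i < m.+1) n by rewrite sum_nat_const card_ord mulnC.
rewrite !big_distrr -!big_split /=.
by apply: leq_sum => i _; rewrite /d; case: ltnP; lia.
Qed.

(** * Vertices as integer sequences with unit steps *)

(* [s i] is an integer representative of the partial sum [u_0 + ... + u_i]. *)
Definition lifts (n m : nat) (s : nat -> int) (u : yoke_vertex n m) : Prop :=
  [/\ (s 0%N %% n)%Z = ycoord (val u) 0,
      ((- s m)%R %% n)%Z = ycoord (val u) m.+1 &
      forall i, i < m -> s i.+1 = (s i + ycoord (val u) i.+1)%R].

Definition unit_steps (m : nat) (s : nat -> int) : Prop :=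
  forall i, i < m -> s i.+1 = s i \/ s i.+1 = (s i + 1)%R.

Lemma ycoord0 (n m : nat) (a b : 'I_n) (t : m.-tuple bool) :
  ycoord (a, t, b) 0 = a.
Proof. by []. Qed.

Lemma ycoord_last (n m : nat) (a b : 'I_n) (t : m.-tuple bool) :
  ycoord (a, t, b) m.+1 = b.
Proof. by rewrite /= eqxx. Qed.

Lemma ycoord_inner (n m i : nat) (a b : 'I_n) (t : m.-tuple bool) :
  i < m -> ycoord (a, t, b) i.+1 = nth false t i.
Proof. by move=> hi; rewrite /= eqSS ltn_eqF. Qed.

Lemma ycoord0_lt (n m : nat) (u : yraw n m) : ycoord u 0 < n.
Proof. by case: u => [[a t] b]; rewrite ycoord0. Qed.

Lemma ycoord_last_lt (n m : nat) (u : yraw n m) : ycoord u m.+1 < n.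
Proof. by case: u => [[a t] b]; rewrite ycoord_last. Qed.

Lemma ycoord_inner_le1 (n m i : nat) (u : yraw n m) : i < m -> ycoord u i.+1 <= 1.
Proof. by case: u => [[a t] b] hi; rewrite ycoord_inner // leq_b1. Qed.

Lemma ycoord_inj (n m : nat) (u v : yraw n m) :
  (forall j, j <= m.+1 -> ycoord u j = ycoord v j) -> u = v.
Proof.
case: u v => [[a t] b] [[a' t'] b'] h.
have -> : a = a' by apply: val_inj; have := h 0 isT; rewrite !ycoord0.
have -> : b = b' by apply: val_inj; have := h _ (leqnn _); rewrite !ycoord_last.
have -> // : t = t'.
apply: val_inj; apply: (@eq_from_nth _ false) => [|i]; rewrite !size_tuple // => hi.
have := h i.+1 (ltnW hi); rewrite !ycoord_inner //.
by case: (nth _ t _); case: (nth _ t' _).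
Qed.

Lemma ycoord_partial_sum (n m : nat) (u : yraw n m) (s : nat -> int) :
  (forall i, i < m -> s i.+1 = (s i + ycoord u i.+1)%R) ->
  forall k, k <= m ->
  (\sum_(j < k.+1) ycoord u j)%N%:Z%R = (s k - s 0%N + (ycoord u 0)%:Z)%R.
Proof.
move=> hs; elim=> [|k IHk] hk; first by rewrite big_ord1 /=; lia.
by rewrite big_ord_recr PoszD IHk 1?ltnW //= hs //; lia.
Qed.

Lemma lift_exists (n m : nat) (u : yoke_vertex n m) : exists s, lifts s u.
Proof.
exists (fun i => Posz (\sum_(j < i.+1) ycoord (val u) j)); split.
- by rewrite big_ord1 modz_nat modn_small ?ycoord0_lt.
- have := valP u; rewrite /yoke_cond big_ord_recr /=.
  move: (\sum_(j < _) _) => S /eqP hS.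
  rewrite -[X in _ = Posz X](@modn_small _ n) ?ycoord_last_lt // -modz_nat.
  apply/eqP; rewrite eqz_mod_dvd -opprD -PoszD; apply/dvdz_mod0P.
  by rewrite -modzNm modz_nat hS mod0z.
- by move=> i _; rewrite big_ord_recr PoszD.
Qed.

Lemma lifts_unit_steps (n m : nat) (s : nat -> int) (u : yoke_vertex n m) :
  lifts s u -> unit_steps m s.
Proof.
move=> [_ _ hs] i hi; have := ycoord_inner_le1 (val u) hi.
by rewrite hs //; lia.
Qed.

(** The end coordinates are the residues of [s 0] and [- s m], the inner ones record the steps, and
    the total telescopes to [0] modulo [n]. *)
Lemma vertex_exists (n m : nat) (s : nat -> int) :
  0 < n -> unit_steps m s -> exists u : yoke_vertex n m, lifts s u.
Proof.
move=> n0 hs.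
have residue (x : int) : {r : 'I_n | (x %% n)%Z = r}.
  have h : `|(x %% n)%Z|%N < n.
    by have := ltz_pmod x (n0 : (0 < n%:Z)%R); have := @modz_ge0 x n; lia.
  by exists (Ordinal h) => /=; have := @modz_ge0 x n; lia.
have [a ha] := residue (s 0%N); have [b hb] := residue (- s m)%R.
pose u : yraw n m := (a, [tuple (s i.+1 != s i) | i < m], b).
have hu i : i < m -> s i.+1 = (s i + ycoord u i.+1)%R.
  move=> hi; rewrite ycoord_inner //.
  rewrite (nth_map (Ordinal hi)) ?size_enum_ord // nth_enum_ord //.
  by case: (hs i hi) => ->; [rewrite eqxx addr0|case: eqP; lia].
have eb : ycoord u m.+1 = b by rewrite ycoord_last.
have ea : ycoord u 0 = a by [].
clearbody u.
have uP : yoke_cond u.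
  rewrite /yoke_cond big_ord_recr /= -eqz_nat -modz_nat PoszD.
  rewrite (ycoord_partial_sum hu) // eb -hb ea -ha.
  rewrite modzDmr addrAC modzDmr addrAC.
  by rewrite subrK subrr mod0z.
by exists (exist _ u uP); split; rewrite ?eb ?ea.
Qed.

Lemma lifts_ext (n m : nat) (s t : nat -> int) (u v : yoke_vertex n m) :
  lifts s u -> lifts t v -> (forall i, i <= m -> s i = t i) -> u = v.
Proof.
move=> [hs0 hsm hs] [ht0 htm ht] hst; apply: val_inj; apply: ycoord_inj => j.
case: j => [|j] hj.
  by apply/eqP; rewrite -eqz_nat -hs0 -ht0 hst.
have [hjm|hjm] := ltnP j m.
  have := hs j hjm; have := ht j hjm; rewrite !hst // ?(ltnW hjm) //; lia.
have -> : j = m by lia.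
by apply/eqP; rewrite -eqz_nat -hsm -htm hst.
Qed.

Lemma lifts_shift (n m : nat) (s : nat -> int) (u : yoke_vertex n m) (k : int) :
  lifts s u -> lifts (fun i => s i + k * n)%R u.
Proof.
move=> [h0 hm hs]; split.
- by rewrite addrC modzMDl.
- by rewrite opprD -mulNr addrC modzMDl.
- by move=> i hi; rewrite hs // addrAC.
Qed.

Lemma lifts_unique (n m : nat) (s t : nat -> int) (u : yoke_vertex n m) :
  lifts s u -> lifts t u ->
  exists k : int, forall i, i <= m -> t i = (s i + k * n)%R.
Proof.
move=> [hs0 _ hs] [ht0 _ ht].
exists ((t 0%N %/ n)%Z - (s 0%N %/ n)%Z)%R; elim=> [|i IHi] hi.
  have := divz_eq (t 0%N) n; have := divz_eq (s 0%N) n; rewrite hs0 ht0 mulrBl.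
  by move: (_ %/ _)%Z (_ %/ _)%Z => q r; lia.
by rewrite hs // ht // IHi 1?ltnW // addrAC.
Qed.

(** * Edges as unit changes of one partial sum *)

Definition bump_at (s : nat -> int) (i : nat) : nat -> int :=
  fun j => (s j + (j == i)%:Z)%R.

(* One unit passes from coordinate [i.+1] to coordinate [i]; on lifts this adds
   [1] to the [i]-th partial sum only. *)
Definition moves_up (n m i : nat) (u v : yraw n m) : Prop :=
  [/\ ycoord v 0 = (ycoord u 0 + (0 == i)) %% n,
      ycoord u m.+1 = (ycoord v m.+1 + (m == i)) %% n &
      forall k, k < m -> ycoord v k.+1 + (k == i) = ycoord u k.+1 + (k.+1 == i)].

Lemma moves_upP (n m i : nat) (u v : yraw n m) : i <= m ->
  moves_up i u v <->
  [forall j : 'I_m.+2, ((j : nat) != i) && ((j : nat) != i.+1) ==>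
    (ycoord u j == ycoord v j)]
  && (yplus1 n m i (ycoord u i) (ycoord v i) &&
      yplus1 n m i.+1 (ycoord v i.+1) (ycoord u i.+1)).
Proof.
move=> hi; have hu := ycoord0_lt u; have hv := ycoord_last_lt v.
have hu' := ycoord_last_lt u; have hv' := ycoord0_lt v.
rewrite /yplus1 !eqSS (ltn_eqF (hi : i < m.+1)) /= orbF.
split=> [[h0 hm h]|/and3P[/forallP h h1 h2]].
- apply/and3P; split.
  + apply/forallP => -[[|j] hj] /=; apply/implyP => /andP[j1 j2].
      by rewrite h0 (negbTE j1) addn0 modn_small.
    have [hjm|hjm] := ltnP j m; first by have := h j hjm; move: j1 j2; lia.
    have ejm : j = m by lia.
    by move: hm; rewrite ejm in j2 *; rewrite -eqSS (negbTE j2) addn0 modn_small // => ->.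
  + case: eqP => [ei|ei]; first by rewrite ei h0 ei eqxx addn1.
    case: i hi ei h0 hm h => [//|i] hi _ h0 hm h.
    by have := h i hi; lia.
  + case: eqP => [ei|ei]; first by rewrite ei hm ei eqxx addn1.
    by have := h i; lia.
- have hj j : j <= m.+1 -> j != i -> j != i.+1 -> ycoord u j = ycoord v j.
    by move=> hjm j1 j2; have := h (Ordinal (hjm : j < m.+2)); rewrite /= j1 j2 => /eqP.
  split.
  + case: eqP => [ei|/eqP ei]; first by move: h1; rewrite -ei /= addn1 => /eqP.
    by rewrite addn0 modn_small // hj.
  + case: eqP => [ei|/eqP ei]; first by move: h2; rewrite -ei eqxx addn1 => /eqP.
    by rewrite addn0 modn_small // hj // ?eqSS //; lia.
  + move=> k hk; have [e1|e1] := eqVneq k i.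
      by move: h2; rewrite -e1 (ltn_eqF hk); lia.
    have [e2|e2] := eqVneq k.+1 i; first by move: h1; rewrite -e2 /=; lia.
    by rewrite hj // ?eqSS //; lia.
Qed.

Lemma yoke_adjP (n m : nat) (u v : yoke_vertex n m) :
  yoke_adj u v <->
  exists2 i, i <= m & moves_up i (val u) (val v) \/ moves_up i (val v) (val u).
Proof.
have sym i : [forall j : 'I_m.+2, ((j : nat) != i) && ((j : nat) != i.+1) ==>
    (ycoord (val v) j == ycoord (val u) j)] =
  [forall j : 'I_m.+2, ((j : nat) != i) && ((j : nat) != i.+1) ==>
    (ycoord (val u) j == ycoord (val v) j)].
  by apply: eq_forallb => j; rewrite [_ == ycoord (val u) j]eq_sym.
split=> [/existsP[i /andP[h1 /orP[h2|h2]]]|[i hi h]].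
- by exists i; [exact: ltn_ord i|right; apply/moves_upP; rewrite ?sym ?h1 // -ltnS].
- by exists i; [exact: ltn_ord i|left; apply/moves_upP; rewrite ?h1 // -ltnS].
- apply/existsP; exists (Ordinal (hi : i < m.+1)) => /=.
  case: h => /(moves_upP _ _ hi)/andP[]; rewrite ?sym => -> -> //=.
  by rewrite orbT.
Qed.

Lemma modz_addn (x : int) (n a e : nat) : a < n ->
  (x %% n)%Z = a <-> ((x + e%:Z)%R %% n)%Z = (a + e) %% n.
Proof.
move=> an; rewrite -modz_nat PoszD; split=> [<-|h].
  by rewrite modzDml.
rewrite -[x](addrK e%:Z%R) -modzDml h modzDml addrK modz_nat.
by rewrite modn_small.
Qed.

(** An equivalence, because an edge gets lifted from either of its ends. *)
Lemma moves_up_lifts (n m i : nat) (s : nat -> int) (u v : yoke_vertex n m) :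
  moves_up i (val u) (val v) -> lifts s u <-> lifts (bump_at s i) v.
Proof.
move=> [h0 hm h].
have e0 : (s 0%N %% n)%Z = ycoord (val u) 0 <->
          (bump_at s i 0 %% n)%Z = ycoord (val v) 0.
  by rewrite h0; apply: modz_addn; apply: ycoord0_lt.
have em : ((- s m)%R %% n)%Z = ycoord (val u) m.+1 <->
          ((- bump_at s i m)%R %% n)%Z = ycoord (val v) m.+1.
  rewrite hm (_ : - s m = - bump_at s i m + (m == i)%:Z)%R; last by rewrite /bump_at; lia.
  by apply: iff_sym; apply: modz_addn; apply: ycoord_last_lt.
split=> -[h0' hm' h']; split; try by [apply/e0|apply/em].
all: clear h0 hm e0 em h0' hm'; move=> k hk.
all: by move: (h k hk) (h' k hk); rewrite /bump_at; clear; lia.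
Qed.

Lemma lifts_moves_up (n m i : nat) (s : nat -> int) (u v : yoke_vertex n m) :
  lifts s u -> lifts (bump_at s i) v -> moves_up i (val u) (val v).
Proof.
move=> [h0 hm h] [h0' hm' h']; split.
- apply/eqP; rewrite -eqz_nat -h0'; apply/eqP.
  exact: (modz_addn (s 0%N) (0 == i) (ycoord0_lt _)).1 h0.
- apply/eqP; rewrite -eqz_nat -hm.
  rewrite (_ : - s m = - bump_at s i m + (m == i)%:Z)%R; last by rewrite /bump_at; lia.
  by apply/eqP; exact: (modz_addn _ (m == i) (ycoord_last_lt _)).1 hm'.
- by move=> k hk; move: (h k hk) (h' k hk); rewrite /bump_at; clear; lia.
Qed.

(** * Graph distance through lifts *)

(** The raised sequence again lifts a vertex, so this supplies the next edge of a walk along which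
    [sdist] decreases. *)
Lemma unit_steps_raise (m i0 : nat) (s t : nat -> int) :
  unit_steps m s -> unit_steps m t -> i0 <= m -> (s i0 < t i0)%R ->
  exists i, [/\ i <= m, (s i < t i)%R & unit_steps m (bump_at s i)].
Proof.
move=> hs ht hi0 hst.
(* Maximizing [i - 2 * s i] picks the smallest value of [s], and the last index
   where it occurs: exactly where [s] can be raised with unit steps kept. *)
have [i hi hmax] := @arg_maxP _ _ 'I_m.+1 (Ordinal (hi0 : i0 < m.+1))
  (fun i => (s i < t i)%R) (fun i => (i%:Z - 2 * s i)%R) hst.
have him := ltn_ord i; exists i; split=> // k hk; rewrite /bump_at.
have := hs k hk; have := ht k hk.
have [e|ne] := eqVneq k i.
  rewrite -e in hi him hmax *.
  have := hmax (Ordinal (hk : k.+1 < m.+1)) => /=; lia.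
have [e|ne'] := eqVneq k.+1 i; last by clear hmax; lia.
rewrite -e in hi him hmax *.
have := hmax (Ordinal (ltnW hk : k < m.+1)) => /=; lia.
Qed.

Definition sdist (m : nat) (s t : nat -> int) : nat :=
  \sum_(i < m.+1) `|s i - t i|%N.

Lemma sdistC (m : nat) (s t : nat -> int) : sdist m s t = sdist m t s.
Proof. by apply: eq_bigr => i _; lia. Qed.

Lemma sdist_bump (m i : nat) (s t : nat -> int) : i <= m -> (s i < t i)%R ->
  sdist m s t = (sdist m (bump_at s i) t).+1.
Proof.
move=> hi hst; have hi' : i < m.+1 by [].
rewrite /sdist (bigD1 (Ordinal hi')) //= [in RHS](bigD1 (Ordinal hi')) //= -addSn.
congr (_ + _); first by rewrite /bump_at eqxx; lia.
apply: eq_bigr => j; rewrite -val_eqE /bump_at /= => /negbTE ->; lia.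
Qed.

Lemma dist_le_lifts (n m : nat) (s t : nat -> int) (u v : yoke_vertex n m) :
  0 < n -> lifts s u -> lifts t v -> dist_le (@yoke_adj n m) u v (sdist m s t).
Proof.
move=> n0; move: {-1}(sdist m s t) (erefl (sdist m s t)) => k.
elim: k s t u v => [|k IHk] s t u v hk hs ht.
  exists [::]; split=> //; apply: (lifts_ext hs ht) => i hi.
  have hi' : i < m.+1 by [].
  move: hk; rewrite /sdist (bigD1 (Ordinal hi')) //=; lia.
have [i0 hi0] : exists i : 'I_m.+1, s i != t i.
  apply/existsP; rewrite -[[exists _, _]]negbK; apply/negP => /existsPn h.
  by move: hk; rewrite /sdist big1 // => i _; have /negPn/eqP -> := h i; lia.
have hs1 := lifts_unit_steps hs; have ht1 := lifts_unit_steps ht.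
have hi0m : i0 <= m by rewrite -ltnS.
have [lt_st|lt_ts|] := ltrgtP (s i0) (t i0); last by move: hi0 => /eqP.
- have [i [him hi hb]] := unit_steps_raise hs1 ht1 hi0m lt_st.
  have [u' hu'] := vertex_exists n0 hb.
  have [|p [hp hl hsz]] := IHk _ _ u' v _ hu' ht.
    by move: hk; rewrite (sdist_bump him hi) => -[].
  exists (u' :: p); split=> //=; rewrite hp andbT.
  by apply/yoke_adjP; exists i => //; left; apply: lifts_moves_up hs hu'.
- have [i [him hi hb]] := unit_steps_raise ht1 hs1 hi0m lt_ts.
  have [v' hv'] := vertex_exists n0 hb.
  have [|p [hp hl hsz]] := IHk _ _ u v' _ hs hv'.
    by move: hk; rewrite sdistC (sdist_bump him hi) sdistC => -[].
  exists (rcons p v); split; rewrite ?last_rcons ?size_rcons //.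
  rewrite rcons_path hp hl; apply/yoke_adjP; exists i => //; right.
  exact: lifts_moves_up ht hv'.
Qed.

Lemma yoke_adj_lifts (n m : nat) (s : nat -> int) (u v : yoke_vertex n m) :
  yoke_adj u v -> lifts s v -> exists2 t, lifts t u & sdist m t s <= 1.
Proof.
have one i (r : nat -> int) : i <= m -> sdist m r (bump_at r i) = 1.
  move=> hi; rewrite sdistC /sdist (bigD1 (Ordinal (hi : i < m.+1))) //=.
  rewrite big1 => [|j]; first by rewrite /bump_at eqxx; lia.
  by rewrite -val_eqE /bump_at /= => /negbTE ->; lia.
move=> /yoke_adjP[i hi [h|h]] hs.
- exists (fun j => s j - (j == i)%:Z)%R.
    apply/(moves_up_lifts _ h).
    case: hs => h0 hm hs; split; rewrite /bump_at ?subrK //.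
    by move=> k hk; rewrite !subrK hs.
  rewrite -(one i (fun j => s j - (j == i)%:Z)%R hi) leq_eqVlt; apply/orP; left.
  by apply/eqP/eq_bigr => j _; rewrite /bump_at subrK.
- exists (bump_at s i); first exact/(moves_up_lifts _ h).
  by rewrite sdistC one.
Qed.

(** The walk is lifted edge by edge, backwards from its end, and the triangle inequality adds up the
    unit changes. *)
Lemma path_lifts (n m : nat) (u : yoke_vertex n m) (p : seq (yoke_vertex n m)) :
  path (@yoke_adj n m) u p ->
  exists s t, [/\ lifts s u, lifts t (last u p) & sdist m s t <= size p].
Proof.
elim: p u => [|v p IHp] u /=.
  have [s hs] := lift_exists u; exists s, s; split=> //.
  by rewrite /sdist big1 // => i _; rewrite subrr.
case/andP=> huv /IHp[s [t [hs ht hst]]].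
have [r hr hrs] := yoke_adj_lifts huv hs.
exists r, t; split=> //; apply: leq_trans (_ : 1 + size p <= _); last by [].
apply: leq_trans (leq_add hrs hst); rewrite -big_split /=.
by apply: leq_sum => i _; lia.
Qed.

(** * The diameter *)

(** Choosing other lifts of the two ends shifts the difference [s - t] by a multiple of [n], which
    is what [k] ranges over. *)
Lemma yoke_diameter_is (n m D : nat) : 0 < n ->
  (forall d : nat -> int, (forall i, i < m -> `|d i.+1 - d i|%N <= 1) ->
     exists k : int, \sum_(i < m.+1) `|d i - (k * n)%R|%N <= D) ->
  (exists s t : nat -> int, [/\ unit_steps m s, unit_steps m t &
     forall k : int, D <= \sum_(i < m.+1) `|(s i - t i)%R - (k * n)%R|%N]) ->
  diameter_is (@yoke_adj n m) D.
Proof.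
move=> n0 upper [s [t [hs ht lower]]]; split=> [u v|].
  have [a ha] := lift_exists u; have [b hb] := lift_exists v.
  have [|k hk] := upper (fun i => a i - b i)%R.
    move=> i hi; have := lifts_unit_steps ha hi; have := lifts_unit_steps hb hi; lia.
  have [p [hp hl hsz]] := dist_le_lifts n0 ha (lifts_shift k hb).
  exists p; split=> //; apply: leq_trans hsz _; apply: leq_trans hk.
  by apply: leq_sum => i _; lia.
have [u hu] := vertex_exists n0 hs; have [v hv] := vertex_exists n0 ht.
exists u, v => D' [p [hp hl hsz]]; apply: leq_trans hsz.
have [a [b [ha hb hab]]] := path_lifts hp; apply: leq_trans hab.
rewrite hl in hb.
have [k hk] := lifts_unique hu ha; have [l hl'] := lifts_unique hv hb.
apply: leq_trans (lower (l - k)%R) _; apply: leq_sum => i _.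
have him : i <= m by rewrite -ltnS.
rewrite (hk i him) (hl' i him) mulrBl; clear.
by move: (s i) (t i) (k * n)%R (l * n)%R => x y z w; lia.
Qed.

(** The extremal difference is [- B, ..., A]. By [A <= B + n] no multiple of [n] beats [0]; the last
    hypothesis keeps the averaging bound below the triangular one, its [+ 1] being absorbed by
    parity. *)
Lemma yoke_diameter_consecutive (n m A B : nat) :
  0 < n -> m = A + B -> B <= A -> A <= B + n ->
  n * m.+1 + 2 * (B * B.-1) <= A * A.+1 + B * B.+1 + 1 ->
  diameter_is (@yoke_adj n m) ('C(A + 1, 2) + 'C(B + 1, 2)).
Proof.
move=> n0 -> hBA hAn hle.
have tA := bin2_double A; have tB := bin2_double B.
apply: yoke_diameter_is => // [d hd|].
  have [|k hk] := exists_close_multiple hd n0 (leq_addr B A); first lia.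
  by exists k; move: hk; rewrite /= addKn; lia.
exists (fun i => i%:Z - B%:Z)%R, (fun=> 0%R).
split=> [i _|i _|k]; [by right; lia|by left|].
have := @consecutive_dist_ge (A + B) B (B%:Z + k * n)%R.
rewrite addnK (eq_bigr (fun i : 'I_(A + B).+1 => `|(i%:Z - B%:Z - 0)%R - (k * n)%R|%N)).
  have hk : (B%:Z + k * n <= B)%R \/ ((A + B)%N%:Z - B%:Z <= B%:Z + k * n)%R.
    by have [h|h] := lerP k 0%R; [left|right]; nia.
  have hB : B.*2 <= A + B by lia.
  by move=> /(_ hB hk); move: (bigop.body _ _ _) => G; clear hk hle; lia.
by move=> i _; lia.
Qed.

Theorem theorem2p3 (n m : nat) (hn : 1 <= n) :
  (m <= n -> diameter_is (@yoke_adj n m) ((n * m.+1)./2)) /\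
  (n = 1 -> 1 <= m ->
     diameter_is (@yoke_adj n m) ('C(uphalf m + 1, 2) + 'C(m./2 + 1, 2))) /\
  (1 < n -> n < m ->
     ((2 %| m - n) \/ n <= uphalf m.+1) ->
     diameter_is (@yoke_adj n m)
       ('C((m + n)./2 + 1, 2) + 'C(uphalf (m - n) + 1, 2))) /\
  (1 < n -> n < m ->
     ~ ((2 %| m - n) \/ n <= uphalf m.+1) ->
     diameter_is (@yoke_adj n m)
       ('C((m + n)./2 + 1, 2) + 'C(uphalf (m - n) + 1, 2) + (n - uphalf m.+1))).
Proof.
split=> [hmn|].
  apply: yoke_diameter_is => // [d hd|].
    (* Taking [A = m] makes the triangle on [m - A] vanish. *)
    have [|k hk] := exists_close_multiple hd hn (leqnn m); first lia.
    exists k; move: hk; rewrite /= subnn.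
    have : m * m.+1 <= n * m.+1 by rewrite leq_mul2r hmn orbT.
    by move: (n * _) (m * _); lia.
  exists (fun i => if i.*2 <= m then n./2 else uphalf n), (fun=> 0%R).
  split=> [i _|i _|k]; [by case: (leqP i.*2 m); case: (leqP i.+1.*2 m); lia|by left|].
  have := halves_dist_ge m k hn.
  rewrite (eq_bigr (fun i : 'I_m.+1 =>
    `|((if (i.*2 <= m)%N then n./2 else uphalf n)%:Z - 0)%R - (k * n)%R|%N)).
    by move: (bigop.body _ _ _) (n * m.+1) => G x; lia.
  by move=> i _; rewrite subr0.
split=> [n1 hm|].
  by subst n; apply: yoke_diameter_consecutive; lia || nia.
split=> [n1 hnm hc|n1 hnm hc].
  apply: yoke_diameter_consecutive; try lia.
  (* For odd [m - n], [n./2 <= B] restates [n <= uphalf m.+1]. *)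
  have [B [hB hm]] : exists B, uphalf (m - n) = B /\
      (m = n + B.*2 \/ m.+1 = n + B.*2 /\ n./2 <= B).
    by exists (uphalf (m - n)); split=> //; lia.
  rewrite hB; case: hm => [hm|[hm hnB]].
    have -> : (m + n)./2 = n + B by lia.
    by case: B hm {hB} => [|B] hm; subst m; nia.
  have -> : (m + n)./2 = n + B - 1 by lia.
  by case: B hm hB hnB => [|B] hm hB hnB; [lia|nia].
have [B hm] : exists B, m = n + B.*2.+1 by exists (m - n)./2; lia.
have -> : (m + n)./2 = n + B by lia.
have -> : uphalf (m - n) = B.+1 by lia.
have tA := bin2_double (n + B); have tB := bin2_double B.+1.
(* With [A = n + B], half the averaging bound exceeds the triangular one by [n - uphalf m.+1], so it
   is the one that decides. *)
have hD : (n * m.+1 + 2 * (B * B.+1))./2 =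
    'C(n + B + 1, 2) + 'C(B.+1 + 1, 2) + (n - uphalf m.+1) by nia.
apply: yoke_diameter_is => // [d hd|].
  have [|| k hk] := @exists_close_multiple m n (n + B) d hd hn; try lia.
  exists k; move: hk; have -> /= : m - (n + B) = B.+1 by lia.
  move: (bigop.body _ _ _) => G; case=> [h|]; first by clear hD; lia.
  rewrite -hD (mulnC B.+1); move: (n * m.+1 + _) => x; clear; lia.
exists (fun i => i%:Z - (if (i.*2 < m)%N then B else B.+1)%:Z)%R, (fun=> 0%R).
split=> [i _|i _|k]; [by case: (ltnP i.*2 m); case: (ltnP i.+1.*2 m); lia|by left|].
have := doubled_middle_dist_ge k hn hm.
rewrite (eq_bigr (fun i : 'I_m.+1 =>
  `|(i%:Z - (if (i.*2 < m)%N then B else B.+1)%:Z - 0)%R - (k * n)%R|%N)).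
  by rewrite -hD; move: (bigop.body _ _ _) (n * m.+1 + _) => G x; clear; lia.
by move=> i _; rewrite subr0.
Qed.
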